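(* Consider the hybrid system with sufficiently smooth ante-event and post-event control vector fields $f^a,f^p:\mathbb{R}^n\times\mathbb{R}^m\times\mathbb{R}\to\mathbb{R}^n$, smooth event function $g:\mathbb{R}^n\times\mathbb{R}\to\mathbb{R}$ and smooth impulse map $\Delta:\mathbb{R}^n\times\mathbb{R}\to\mathbb{R}^n$, as described in the context. Let $\xi(t)=(\alpha(t),\mu(t))$, $t\in[t_0,t_1]$, be a nominal state-input trajectory of this system with initial condition $\alpha^a(t_0)=x_0$, integrable input $\mu$, nominal event time $\tau\in[t_0,t_1]$, and extended ante- and post-event trajectories $\bar\alpha^a(t),\bar\alpha^p(t)$, $t\in[t_0,t_1]$. Assume the transversality condition $$D_1 g(\alpha^a(\tau),\tau)\cdot f^a(\alpha^a(\tau),\mu(\tau),\tau)+D_2 g(\alpha^a(\tau),\tau)\cdot 1\neq 0 .$$ Let $z_0\in\mathbb{R}^n$, let $v(t)\in\mathbb{R}^m$, $t\in[t_0,t_1]$, be an integrable curve, and let $x_\varepsilon(t)$, $t\in[t_0,t_1]$, be the perturbed state trajectory of the hybrid system with initial condition $x_\varepsilon(t_0)=x_0+\varepsilon z_0$ and input $u_\varepsilon(t)=\mu(t)+\varepsilon v(t)$, with perturbed event time $\tau_\varepsilon$. Then, as $\varepsilon\to 0$, uniformly in $t\in[t_0,t_1]$, $$x_\varepsilon(t)=\begin{cases}\bar\alpha^a(t)+\varepsilon\,\bar z^a(t)+o(\varepsilon), & t<\tau_\varepsilon,\\ \bar\alpha^p(t)+\varepsilon\,\bar z^p(t)+o(\varepsilon),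 & t\ge\tau_\varepsilon,\end{cases}$$ where the extended ante- and post-event linearization trajectories $\bar z^a(t),\bar z^p(t)$, $t\in[t_0,t_1]$, are given by $$\bar z^a(t_0)=z_0,\qquad \dot{\bar z}^a(t)=A^a(t)\bar z^a(t)+B^a(t)v(t),\quad t\in[t_0,t_1],$$ $$\bar z^p(\tau)=\bar z^a(\tau)+H(\tau)\,\bar z^a(\tau),\qquad \dot{\bar z}^p(t)=A^p(t)\bar z^p(t)+B^p(t)v(t),\quad t\in[t_0,t_1],$$ with, for $s\in\{a,p\}$, $$A^s(t)=D_1 f^s(\bar\alpha^s(t),\mu(t),t),\qquad B^s(t)=D_2 f^s(\bar\alpha^s(t),\mu(t),t),$$ and $$H(\tau)=\frac{f^+-f^--\dot\Delta^-}{\dot g^-}\,D_1 g^-+D_1\Delta^-,$$ where $\alpha^p(\tau)=\alpha^a(\tau)+\Delta(\alpha^a(\tau),\tau)$, $f^+=f^p(\alpha^p(\tau),\mu(\tau),\tau)$, $f^-=f^a(\alpha^a(\tau),\mu(\tau),\tau)$, $D_k\Delta^-=D_k\Delta(\alpha^a(\tau),\tau)$ and $D_k g^-=D_k g(\alpha^a(\tau),\tau)$ for $k\in\{1,2\}$, $\dot\Delta^-=D_1\Delta^-\cdot f^-+D_2\Delta^-\cdot 1$, and $\dot g^-=D_1 g^-\cdot f^-+D_2 g^-\cdot 1$.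
   Context: $D_k$ denotes the derivative with respect to the $k$-th argument; $D_1 g$ is a row vector, so $\frac{f^+-f^--\dot\Delta^-}{\dot g^-}D_1 g^-$ is an $n\times n$ matrix (column times row). Hybrid system. The state is $x\in\mathbb{R}^n$ and the input is $u\in\mathbb{R}^m$. For every $t$, the level set $\{x: g(x,t)=0\}$ is a smooth $(n-1)$-dimensional embedded submanifold of $\mathbb{R}^n$. Given $x_0\in\mathbb{R}^n$ and an integrable input $\mu(t)$, $t\in[t_0,t_1]$, the ante-event trajectory $\alpha^a$ is the solution of $\dot x=f^a(x,\mu(t),t)$, $x(t_0)=x_0$, on $[t_0,\tau]$, up to the occurrence of a triggering event at the time $\tau\in[t_0,t_1]$ at which $g(\alpha^a(\tau),\tau)=0$. At the event time the state jumps according to $\alpha^p(\tau)=\alpha^a(\tau)+\Delta(\alpha^a(\tau),\tau)$. The post-event trajectory $\alpha^p$ on $[\tau,t_1]$ is the solution of $\dot x=f^p(x,\mu(t),t)$ starting from $\alpha^p(\tau)$ at time $\tau$. The nominal state trajectory is $\alpha(t)=\alpha^a(t)$ for $t\in[t_0,\tau)$ and $\alpha(t)=\alpha^p(t)$ for $t\in[\tau,t_1]$. A single jump is considered. Extended trajectories. $\bar\alpha^a$ and $\bar\alpha^p$ denote the extensions of $\alpha^a$ and $\alpha^p$ to the whole interval $[t_0,t_1]$ obtained by, respectively, forward and backward integration in time from $\tau$ of $\dot x=f^a(x,\mu(t),t)$ and $\dot x=f^p(x,\mu(t),t)$. Perturbed trajectory. For $\varepsilon\in\mathbb{R}$ small,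 the perturbed trajectory is generated by the same hybrid system: $x^a_\varepsilon(t_0)=x_0+\varepsilon z_0$; $\dot x^a_\varepsilon=f^a(x^a_\varepsilon,u_\varepsilon,t)$ on $[t_0,\tau_\varepsilon]$; the perturbed event time $\tau_\varepsilon$ is implicitly defined by $g(x^a_\varepsilon(\tau_\varepsilon),\tau_\varepsilon)=0$ (with $\tau_0=\tau$); $x^p_\varepsilon(\tau_\varepsilon)=x^a_\varepsilon(\tau_\varepsilon)+\Delta(x^a_\varepsilon(\tau_\varepsilon),\tau_\varepsilon)$; $\dot x^p_\varepsilon=f^p(x^p_\varepsilon,u_\varepsilon,t)$ on $[\tau_\varepsilon,t_1]$. Then $x_\varepsilon(t)=x^a_\varepsilon(t)$ for $t<\tau_\varepsilon$ and $x_\varepsilon(t)=x^p_\varepsilon(t)$ for $t\ge\tau_\varepsilon$. The perturbed ante- and post-event trajectories are likewise extendable over the whole interval $[t_0,t_1]$ by forward and backward integration from $\tau_\varepsilon$.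
   Formalization: Added: the ODEs of both extended nominal trajectories hold at the time τ (automatic if μ is continuous there), and D_1 f^s and (D_2 f^s)v have an integrable bound near the nominal trajectory (automatic for bounded μ, v). τ_ε is read as the branch of zeros continuous at ε=0. *)

(* Defs.v *)
From HB Require Import structures.
From mathcomp Require Import all_boot all_order all_algebra.
From mathcomp Require Import all_classical all_reals all_analysis.

Set Implicit Arguments.
Unset Strict Implicit.
Unset Printing Implicit Defensive.

Import Order.TTheory GRing.Theory Num.Theory.
Import numFieldNormedType.Exports.

Local Open Scope classical_set_scope.
Local Open Scope ring_scope.

Section calculus.
Context {R : realType}.

(* The domains used below are finite-dimensional, so continuity of all the
   maps x |-> 'd F x v is continuity of x |-> 'd F x in operator norm. *)
Definition C1_on (V W : normedModType R) (U : set V) (F : V -> W) : Prop :=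
  forall x, U x -> differentiable F x /\
    forall v : V, {for x, continuous (fun y => 'd F y v : W)}.

Definition C1 (V W : normedModType R) (F : V -> W) : Prop := C1_on setT F.

(* Matrices of Fréchet derivatives acting on column vectors (the library's
   [jacobian] acts on row vectors). *)
Definition jac p q (F : 'cV[R]_p -> 'cV[R]_q) (x : 'cV[R]_p) : 'M[R]_(q, p) :=
  \matrix_(i, j) ('d F x (delta_mx j 0) : 'cV[R]_q) i 0.

Definition grad p (G : 'cV[R]_p -> R) (x : 'cV[R]_p) : 'rV[R]_p :=
  \row_j ('d G x (delta_mx j 0) : R).

(* Embedded submanifold of codimension 1: locally the zero set of a
   submersion. *)
Definition embedded_hypersurface n (S : set 'cV[R]_n) : Prop :=
  forall p, S p -> exists (U : set 'cV[R]_n) (phi : 'cV[R]_n -> R),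
    [/\ open U, U p, C1_on U phi,
        forall x, U x -> grad phi x != 0
      & S `&` U = [set x | phi x = 0] `&` U].

Definition integrable_curve p (a b : R) (u : R -> 'cV[R]_p) : Prop :=
  forall i, (@lebesgue_measure R).-integrable `[a, b]
    (EFin \o (fun s => u s i 0)).

(* Carathéodory solution on [a, b] of x' = f(x, u(t), t): u is only integrable,
   so the equation is understood in integral form. *)
Definition solution n m (f : 'cV[R]_n -> 'cV[R]_m -> R -> 'cV[R]_n)
    (u : R -> 'cV[R]_m) (a b : R) (x : R -> 'cV[R]_n) : Prop :=
  integrable_curve a b (fun s => f (x s) (u s) s) /\
  forall s t, a <= s -> s <= t -> t <= b -> forall i,
    x t i 0 - x s i 0 =
      \int[@lebesgue_measure R]_(r in `[s, t]) (f (x r) (u r) r i 0).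

(* x' = f(x, u, t) at the single time tau, with the derivative of x taken
   within [a, b] (one-sided if tau is an endpoint). For an extended trajectory
   x this holds whenever u is continuous at tau. *)
Definition ode_at n m (f : 'cV[R]_n -> 'cV[R]_m -> R -> 'cV[R]_n)
    (u : R -> 'cV[R]_m) (a b : R) (x : R -> 'cV[R]_n) (tau : R) : Prop :=
  (fun t => (t - tau)^-1 *: (x t - x tau)) @ within `[a, b] (tau^')
    --> f (x tau) (u tau) tau.

(* Integrable bound, near (x, mu), on the derivatives of f that enter the
   linearization in the direction v. It is automatic for C^1 fields f when mu
   and v are bounded, and, for unbounded integrable mu and v, when D_2 f is
   bounded and |D_1 f| <= c (1 + |u|) on sets with (x, t) bounded (e.g. for
   control-affine f). For unbounded inputs it cannot be dropped: with
   f(u) = sin(u^3)^2, v = 1 and mu equal to (pi k)^(1/3) on consecutive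
   intervals of length k^(-3/2), the linearization is constant while the
   perturbed trajectory deviates by an amount of order epsilon^(3/4). *)
Definition dominated_along n m (f : 'cV[R]_n -> 'cV[R]_m -> R -> 'cV[R]_n)
    (a b : R) (x : R -> 'cV[R]_n) (mu v : R -> 'cV[R]_m) : Prop :=
  exists (r : R) (k : R -> R),
    [/\ 0 < r,
        (@lebesgue_measure R).-integrable `[a, b] (EFin \o k)
      & forall (t : R) (y : 'cV[R]_n) (e : R), a <= t -> t <= b ->
          `|y - x t| <= r -> `|e| <= r ->
          `|jac (fun y' => f y' (mu t + e *: v t) t) y| <= k t /\
          `|jac (fun w => f y w t) (mu t + e *: v t) *m v t| <= k t].

End calculus.

Record hybrid_system (R : realType) (n m : nat) := HybridSystem {
  fa : 'cV[R]_n -> 'cV[R]_m -> R -> 'cV[R]_n;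
  fp : 'cV[R]_n -> 'cV[R]_m -> R -> 'cV[R]_n;
  ev : 'cV[R]_n -> R -> R;
  jump : 'cV[R]_n -> R -> 'cV[R]_n
}.

Section hybrid.
Context {R : realType} {n m : nat} (S : hybrid_system R n m).

Definition smooth_system : Prop :=
  [/\ C1 (fun p : 'cV[R]_n * 'cV[R]_m * R => fa S p.1.1 p.1.2 p.2),
      C1 (fun p : 'cV[R]_n * 'cV[R]_m * R => fp S p.1.1 p.1.2 p.2),
      C1 (fun p : 'cV[R]_n * R => ev S p.1 p.2),
      C1 (fun p : 'cV[R]_n * R => jump S p.1 p.2)
    & forall t, embedded_hypersurface [set x | ev S x t = 0]].

(* xa and xp are only constrained on [t0, tau] and [tau, t1] respectively. *)
Definition hybrid_trajectory (t0 t1 : R) (x0 : 'cV[R]_n) (u : R -> 'cV[R]_m)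
    (tau : R) (xa xp : R -> 'cV[R]_n) : Prop :=
  [/\ t0 <= tau <= t1,
      xa t0 = x0 /\ solution (fa S) u t0 tau xa,
      ev S (xa tau) tau = 0,
      xp tau = xa tau + jump S (xa tau) tau
    & solution (fp S) u tau t1 xp].

Definition fminus (mu : R -> 'cV[R]_m) tau (xa : R -> 'cV[R]_n) : 'cV[R]_n :=
  fa S (xa tau) (mu tau) tau.

Definition fplus (mu : R -> 'cV[R]_m) tau (xp : R -> 'cV[R]_n) : 'cV[R]_n :=
  fp S (xp tau) (mu tau) tau.

Definition D1g tau (xa : R -> 'cV[R]_n) : 'rV[R]_n :=
  grad (fun x => ev S x tau) (xa tau).

Definition D2g tau (xa : R -> 'cV[R]_n) : R :=
  derive1 (fun s => ev S (xa tau) s) tau.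

Definition gdot (mu : R -> 'cV[R]_m) tau (xa : R -> 'cV[R]_n) : R :=
  (D1g tau xa *m fminus mu tau xa) 0 0 + D2g tau xa.

Definition D1jump tau (xa : R -> 'cV[R]_n) : 'M[R]_n :=
  jac (fun x => jump S x tau) (xa tau).

Definition D2jump tau (xa : R -> 'cV[R]_n) : 'cV[R]_n :=
  derive1 (fun s => jump S (xa tau) s) tau.

Definition jumpdot (mu : R -> 'cV[R]_m) tau (xa : R -> 'cV[R]_n) : 'cV[R]_n :=
  D1jump tau xa *m fminus mu tau xa + D2jump tau xa.

Definition Hmat (mu : R -> 'cV[R]_m) tau (xa xp : R -> 'cV[R]_n) : 'M[R]_n :=
  ((gdot mu tau xa)^-1 *:
     (fplus mu tau xp - fminus mu tau xa - jumpdot mu tau xa)) *m D1g tau xa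
  + D1jump tau xa.

End hybrid.

Definition linA (R : realType) n m
    (f : 'cV[R]_n -> 'cV[R]_m -> R -> 'cV[R]_n)
    (x : R -> 'cV[R]_n) (mu : R -> 'cV[R]_m) (t : R) : 'M[R]_n :=
  jac (fun y => f y (mu t) t) (x t).

Definition linB (R : realType) n m
    (f : 'cV[R]_n -> 'cV[R]_m -> R -> 'cV[R]_n)
    (x : R -> 'cV[R]_n) (mu : R -> 'cV[R]_m) (t : R) : 'M[R]_(n, m) :=
  jac (fun w => f (x t) w t) (mu t).

Definition switched (R : realType) (T : Type) (tau : R) (xa xp : R -> T)
    (t : R) : T :=
  if t < tau then xa t else xp t.

(* Main.v *)
Require Import Defs.
From HB Require Import structures.
From mathcomp Require Import all_boot all_order all_algebra.
From mathcomp Require Import all_classical all_reals all_analysis.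
From mathcomp Require Import measurable_realfun ring lra.

Import Order.TTheory GRing.Theory Num.Theory.
Import numFieldNormedType.Exports.

Local Open Scope classical_set_scope.
Local Open Scope ring_scope.

(** Away from the event the statement is differentiable dependence of a
    Caratheodory solution on its initial value and its input.  Let w be the
    deviation of the perturbed solution from the nominal one.  The integrable
    bound k on the derivatives gives |w'| <= n k |w| + |e| k as long as w stays
    in the ball where k is valid, so a Gronwall estimate that at the same time
    keeps w in that ball yields w = O(e) ([perturbation_bound]).  The rescaled
    error Y = w / e - z then satisfies |Y'| <= n k |Y| + H_e, where H_e tends
    to 0 pointwise by differentiability of the field and is bounded by a
    multiple of k.  By dominated convergence the integral of H_e tends to 0,
    and a second Gronwall estimate gives Y = o(1) uniformly
    ([linearization_seq], [linearization_near]).  The Gronwall estimate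
    ([gronwall]) cuts the time interval into pieces on which the integral of
    n k is at most 1/2, so that the supremum of |w| on a piece is absorbed
    into the left-hand side.

    At the event, put delta = tau_e - tau.  The ante-event state at tau_e is
    alpha + delta f^- + e za(tau) + o(|delta| + |e|).  Inserting this into
    g = 0 gives gdot delta + e D_1 g za(tau) = o(|delta| + |e|), hence
    delta = O(e) by transversality, and delta = - e D_1 g za(tau) / gdot + o(e)
    ([negl_event_time]).  Expanding the jump map and the extended post-event
    trajectory at tau_e in the same way, the post-event deviation at tau_e is
    e zp(tau) - (delta + e D_1 g za(tau) / gdot) (f^+ - f^- - Deltadot) + o(e):
    the jump matrix H collects exactly the terms proportional to e, and the
    middle term is o(e).  So the perturbed post-event trajectory starts within
    o(e) of the linearized one, and differentiable dependence applied on
    [tau_e, t1] finishes the proof. *)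

Set Implicit Arguments.
Unset Strict Implicit.
Unset Printing Implicit Defensive.

(** * Entrywise maximum norm of matrices *)

Section mx.
Context {R : realType}.

Lemma entry_le_norm p q (M : 'M[R]_(p, q)) i j : `|M i j| <= `|M|.
Proof.
rewrite [leRHS]/Num.Def.normr/= mx_normrE.
by apply/bigmax_geP; right => /=; exists (i, j).
Qed.

Lemma mxnorm_le p q (M : 'M[R]_(p, q)) c :
  0 <= c -> (forall i j, `|M i j| <= c) -> `|M| <= c.
Proof.
by move=> c0 h; rewrite [leLHS]/Num.Def.normr/= mx_normrE bigmax_le.
Qed.

Lemma norm_mulmx p q (M : 'M[R]_(p, q)) (x : 'cV[R]_q) :
  `|M *m x| <= q%:R * `|M| * `|x|.
Proof.
apply: mxnorm_le => [|i j]; first by rewrite !mulr_ge0.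
rewrite mxE (le_trans (ler_norm_sum _ _ _))//.
rewrite -mulrA mulr_natl -[X in _ *+ X]card_ord -sumr_const ler_sum// => l _.
by rewrite normrM ler_pM// entry_le_norm.
Qed.

End mx.

(** * Gronwall estimate on intervals of small mass *)

Section gronwall.
Context {R : realType}.

(** The form in which absolute continuity of the integral provides uniform
    continuity of Caratheodory solutions; it restricts to subintervals without
    any change of topology. *)
Definition ucont (V : normedModType R) (a b : R) (h : R -> V) :=
  forall e : R, 0 < e -> exists2 d : R, 0 < d & forall s t,
    a <= s -> s <= t -> t <= b -> t - s <= d -> `|h t - h s| <= e.

Lemma ucontS (V : normedModType R) (a b c d : R) (h : R -> V) :
  a <= c -> d <= b -> ucont a b h -> ucont c d h.
Proof.
move=> ac db h_ e e0; have [r r0 hr] := h_ e e0; exists r => // s t cs st td.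
by apply: hr => //; lra.
Qed.

Lemma ucont_norm (V : normedModType R) (a b : R) (h : R -> V) :
  ucont a b h -> ucont a b (fun t => `|h t|).
Proof.
move=> h_ e e0; have [r r0 hr] := h_ e e0; exists r => // s t as_ st td tr.
exact: le_trans (ler_dist_dist _ _) (hr _ _ _ _ _ _).
Qed.

Lemma ucont_continuous (V : normedModType R) (a b : R) (h : R -> V) :
  ucont a b h -> {within `[a, b], continuous h}.
Proof.
move=> uh; apply/subspace_continuousP => x; rewrite /= in_itv/= => /andP[ax xb].
apply/cvgrPdist_le => e e0; have [d d0 hd] := uh e e0.
apply/nbhs_ballP; exists d => //= y /= xy; rewrite in_itv/= => /andP[ay yb].
move: xy; rewrite /ball/= ltr_norml => /andP[xy1 xy2].
case: (leP x y) => [xy|/ltW yx].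
  by rewrite distrC; apply: hd => //; lra.
by apply: hd => //; lra.
Qed.

(** The estimate is only available while [phi <= r], so it is applied up to the
    first time at which [phi] reaches a level above [2 * (beta + gamma)]: there
    it bounds that level by [beta + gamma] plus half of itself. *)
Lemma gronwall_step (phi : R -> R) p q r beta gamma :
  p <= q -> ucont p q phi -> phi p <= beta -> 0 <= beta + gamma -> 0 <= gamma ->
  (forall t M, p <= t <= q -> 0 <= M <= r ->
     (forall s, p <= s <= t -> phi s <= M) ->
     phi t <= phi p + M / 2 + gamma) ->
  2 * (beta + gamma) < r ->
  forall t, p <= t <= q -> phi t <= 2 * (beta + gamma).
Proof.
move=> pq uc phip bg0 g0 H Br t /andP[pt tq]; rewrite leNgt; apply/negP => Bt.
have [B' [BB' B't B'r]] : exists B',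
    [/\ 2 * (beta + gamma) < B', B' <= phi t & B' <= r].
  exists (Num.min (phi t) r); split.
  - by rewrite lt_min Bt.
  - by rewrite ge_min lexx.
  - by rewrite ge_min lexx orbT.
(* T is the first time at which phi reaches the level B' *)
pose E := [set s | p <= s <= t /\ B' <= phi s].
have Et : E t by split => //; rewrite pt lexx.
have hE : has_inf E by split; [exists t | exists p => s [/andP[]]].
pose T := inf E.
have pT : p <= T by apply: lb_le_inf; [exists t | move=> s [/andP[]]].
have Tt : T <= t by apply: ge_inf => //; exact: hE.2.
have below s : p <= s -> s < T -> phi s < B'.
  move=> ps sT; rewrite ltNge; apply/negP => h.
  have : T <= s by apply: ge_inf; [exact: hE.2 | split => //; rewrite ps; lra].
  lra.
have phiT : B' <= phi T.
  rewrite leNgt; apply/negP => h.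
  have [d d0 hd] := uc ((B' - phi T) / 2) ltac:(lra).
  have [s [/andP[ps st] Bs] sT] := inf_adherent d0 hE.
  have Ts : T <= s by apply: ge_inf; [exact: hE.2 | split => //; rewrite ps].
  have := hd T s pT Ts ltac:(lra) ltac:(rewrite /T; lra).
  by rewrite ler_norml => /andP[_]; lra.
have phiT' : phi T <= B'.
  rewrite leNgt; apply/negP => h.
  have pT' : p < T.
    rewrite lt_neqAle pT andbT; apply/eqP => E0; move: h; rewrite -E0; lra.
  have [d d0 hd] := uc ((phi T - B') / 2) ltac:(lra).
  have [s [ps ds sT]] : exists s, [/\ p <= s, T - d <= s & s < T].
    exists (Num.max p (T - d)); split.
    - by rewrite le_max lexx.
    - by rewrite le_max lexx orbT.
    - by rewrite gt_max pT' ltrBlDr ltrDl.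
  have := below s ps sT.
  have := hd s T ps ltac:(lra) ltac:(lra) ltac:(lra).
  by rewrite ler_norml => /andP[_]; lra.
have : phi T <= phi p + B' / 2 + gamma.
  apply: H; [by rewrite pT; lra| by rewrite B'r andbT; lra|].
  move=> s /andP[ps sT]; case: (ltgtP s T) sT => // [sT _|-> _]//.
  exact/ltW/below.
lra.
Qed.

(** Iterating the step on N consecutive intervals of length [del] doubles the
    bound each time: with [X = beta + 2 * gamma], the bound after i intervals is
    [2 ^+ i * X - 2 * gamma], the i-th iterate of b |-> 2 * (b + gamma) at beta. *)
Lemma gronwall (phi : R -> R) c d r beta gamma (N : nat) del :
  0 <= del -> d - c <= N%:R * del ->
  ucont c d phi -> phi c <= beta -> 0 <= beta -> 0 <= gamma ->
  (forall s t M, c <= s -> s <= t -> t <= d -> t - s <= del -> 0 <= M <= r ->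
     (forall x, s <= x <= t -> phi x <= M) ->
     phi t <= phi s + M / 2 + gamma) ->
  2 ^+ N * (beta + 2 * gamma) < r ->
  forall t, c <= t <= d -> phi t <= 2 ^+ N * (beta + 2 * gamma).
Proof.
move=> del0 Ndel uc phic b0 g0 H Br t.
pose X := beta + 2 * gamma.
have X0 : 0 <= X by rewrite /X; lra.
suff P (i : nat) : (i <= N)%N -> forall t, c <= t <= d -> t - c <= i%:R * del ->
    phi t <= 2 ^+ i * X - 2 * gamma.
  move=> /andP[ct td]; have := P N (leqnn _) t ltac:(by rewrite ct) ltac:(lra).
  rewrite -/X; lra.
elim: i => [_|i IH iN] {}t /andP[ct td].
  rewrite mul0r => tc; have -> : t = c by lra.
  by rewrite expr0 /X; lra.
have pos2 : (0 : R) <= 2 ^+ i by rewrite exprn_ge0.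
have le0 : 0 <= 2 ^+ i * X by rewrite mulr_ge0.
rewrite -natr1 mulrDl mul1r exprS => tc.
have {}IH := IH (ltnW iN).
case: (leP (t - c) (i%:R * del)) => h.
  by have := IH t ltac:(by rewrite ct) h; lra.
pose p := c + i%:R * del.
have cp : c <= p by rewrite lerDl mulr_ge0.
have IHp : phi p <= 2 ^+ i * X - 2 * gamma.
  by apply: IH; [rewrite cp /p; lra|rewrite /p; lra].
have := @gronwall_step phi p t r (2 ^+ i * X - 2 * gamma) gamma.
have -> : 2 * (2 ^+ i * X - 2 * gamma + gamma) = 2 * 2 ^+ i * X - 2 * gamma.
  by ring.
have X2 : 2 * gamma <= X by rewrite /X; lra.
have iX : X <= 2 ^+ i * X by rewrite ler_peMl// exprn_ege1//; lra.
apply => //.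
- by rewrite /p; lra.
- exact: ucontS uc.
- lra.
- move=> u M /andP[pu ut] M0 Hs; apply: H => //; [lra| rewrite /p; lra].
- apply: le_lt_trans Br; rewrite -/X -exprS.
  have : 2 ^+ i.+1 * X <= 2 ^+ N * X by rewrite ler_wpM2r// ler_eXn2l//; lra.
  lra.
- by rewrite lexx andbT /p; lra.
Qed.

End gronwall.

(** * Indefinite integrals of vector-valued functions *)

Section primitive.
Context {R : realType}.
Notation leb := (@lebesgue_measure R).

Lemma integrable_itvS (h : R -> R) a b c d : a <= c -> d <= b ->
  leb.-integrable `[a, b] (EFin \o h) -> leb.-integrable `[c, d] (EFin \o h).
Proof.
move=> ac db; apply: integrableS => //.
by apply: subset_itv; rewrite bnd_simp.
Qed.

Lemma integrable_normr (h : R -> R) (D : set R) : measurable D ->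
  leb.-integrable D (EFin \o h) -> leb.-integrable D (EFin \o (fun x => `|h x|)).
Proof. by move=> mD hi; have := integrable_norm hi. Qed.

Lemma Rintegral_itvS (h : R -> R) a b c d : a <= c -> d <= b ->
  leb.-integrable `[a, b] (EFin \o h) -> (forall t, a <= t <= b -> 0 <= h t) ->
  \int[leb]_(x in `[c, d]) h x <= \int[leb]_(x in `[a, b]) h x.
Proof.
move=> ac db hi h0; rewrite /Rintegral fine_le//.
- by apply: integrable_fin_num => //; exact: integrable_itvS hi.
- exact: integrable_fin_num.
apply: ge0_subset_integral => //.
- exact: measurable_int hi.
- by apply: subset_itv; rewrite bnd_simp.
Qed.

(** Absolute continuity of the integral, on intervals. *)
Lemma integral_modulus (h : R -> R) a b : leb.-integrable `[a, b] (EFin \o h) ->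
  forall e : R, 0 < e -> exists2 d : R, 0 < d & forall s t,
    a <= s -> s <= t -> t <= b -> t - s <= d ->
    \int[leb]_(x in `[s, t]) `|h x| <= e.
Proof.
move=> hi e e0.
have hT : leb.-integrable setT (EFin \o (h \_ `[a, b])).
  by rewrite -restrict_EFin; apply: (integrable_mkcond _ _).1.
have [d [d0 hd]] := integral_normr_continuous hT e0.
exists (d / 2); first by rewrite divr_gt0.
move=> s t as_ st tb tsd.
have -> : \int[leb]_(x in `[s, t]) `|h x| =
          \int[leb]_(x in `[s, t]) `|(h \_ `[a, b]) x|.
  apply: eq_Rintegral => x; rewrite inE/= in_itv/= => /andP[sx xt].
  by rewrite patchE mem_set// /= in_itv/= (le_trans as_ sx) (le_trans xt tb).
apply/ltW/hd => //; rewrite [ltLHS]lebesgue_measure_itv/= lte_fin.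
case: ifPn => _; last by rewrite lte_fin.
rewrite -EFinB lte_fin; lra.
Qed.

(** [solution f u c d x] is by definition the instance
    [primitive c d (fun s => f (x s) (u s) s) x]; unlike [solution], this form
    is stable under linear combinations. *)
Definition primitive n (c d : R) (G X : R -> 'cV[R]_n) :=
  integrable_curve c d G /\
  forall s t, c <= s -> s <= t -> t <= d -> forall i,
    X t i 0 - X s i 0 = \int[leb]_(r in `[s, t]) (G r i 0).

Lemma primitiveS n a b c d (G X : R -> 'cV[R]_n) : a <= c -> d <= b ->
  primitive a b G X -> primitive c d G X.
Proof.
move=> ac db [Gi GX]; split=> [i|s t cs st td i].
  exact: integrable_itvS (Gi i).
by apply: GX => //; lra.
Qed.

Lemma primitiveB n c d (G H X Y : R -> 'cV[R]_n) :
  primitive c d G X -> primitive c d H Y ->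
  primitive c d (fun t => G t - H t) (fun t => X t - Y t).
Proof.
move=> [Gi GX] [Hi HY]; split=> [i|s t cs st td i].
  apply: eq_integrable (integrableB _ (Gi i) (Hi i)) => // x _.
  by rewrite /= !mxE EFinB.
under eq_Rintegral do rewrite !mxE.
rewrite !mxE RintegralB//.
- by rewrite -GX// -HY//; ring.
- exact: integrable_itvS (Gi i).
- exact: integrable_itvS (Hi i).
Qed.

Lemma primitiveZ n c d (G X : R -> 'cV[R]_n) (a : R) : primitive c d G X ->
  primitive c d (fun t => a *: G t) (fun t => a *: X t).
Proof.
move=> [Gi GX]; split=> [i|s t cs st td i].
  apply: eq_integrable (integrableZl _ a (Gi i)) => // x _.
  by rewrite /= !mxE EFinM.
under eq_Rintegral do rewrite !mxE.
rewrite !mxE RintegralZl//; last exact: integrable_itvS (Gi i).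
by rewrite -GX//; ring.
Qed.

Lemma primitive_norm_le n c d (G X : R -> 'cV[R]_n) (h : R -> R) s t :
  primitive c d G X -> c <= s -> s <= t -> t <= d ->
  leb.-integrable `[s, t] (EFin \o h) ->
  (forall x, s <= x <= t -> `|G x| <= h x) ->
  `|X t - X s| <= \int[leb]_(x in `[s, t]) h x.
Proof.
move=> [Gi GX] cs st td hi Gh.
apply: mxnorm_le => [|i j].
  apply: Rintegral_ge0 => x; rewrite /= in_itv/= => /Gh; exact: le_trans.
have Gi' : leb.-integrable `[s, t] (EFin \o (fun x => G x i 0)).
  exact: integrable_itvS (Gi i).
rewrite ord1 !mxE GX// (le_trans (le_normr_Rintegral _ _))//.
apply: le_Rintegral => //; first exact: integrable_normr.
move=> x; rewrite /= in_itv/= => /Gh; apply: le_trans; exact: entry_le_norm.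
Qed.

Lemma integrable_sum_norm n c d (G : R -> 'cV[R]_n) : integrable_curve c d G ->
  leb.-integrable `[c, d] (EFin \o (fun t => \sum_i `|G t i 0|)).
Proof.
move=> Gi.
have : leb.-integrable `[c, d] (fun t => \sum_(i <- index_enum 'I_n) (`|G t i 0|)%:E)%E.
  by apply: integrable_sum => // i _; apply: integrable_normr => //; exact: Gi.
by apply: eq_integrable => // x _ /=; rewrite sumEFin.
Qed.

Lemma primitive_ucont n c d (G X : R -> 'cV[R]_n) :
  primitive c d G X -> ucont c d X.
Proof.
move=> GX e e0; have Gs := integrable_sum_norm GX.1.
have [r r0 hr] := integral_modulus Gs e0; exists r => // s t cs st td tsr.
apply: le_trans (hr s t cs st td tsr).
apply: (primitive_norm_le GX) => //.
  by apply: integrable_normr => //; exact: integrable_itvS Gs.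
move=> x _; rewrite [leRHS]ger0_norm ?sumr_ge0//.
apply: mxnorm_le => [|i j]; first exact: sumr_ge0.
by rewrite ord1 (bigD1 i)//= lerDl sumr_ge0.
Qed.

Lemma ucont_bounded (V : normedModType R) a b (h : R -> V) : ucont a b h ->
  exists2 C : R, 0 <= C & forall t, a <= t <= b -> `|h t| <= C.
Proof.
move=> uh; case: (leP a b) => ab; last first.
  by exists 0 => // t /andP[at_ tb]; move: (le_trans at_ tb); rewrite leNgt ab.
have [c cab hc] := EVT_max ab (ucont_continuous (ucont_norm uh)).
by exists `|h c| => // t tab; apply: hc; rewrite in_itv.
Qed.

Lemma ucont_measurable a b (h : R -> R) : ucont a b h ->
  measurable_fun `[a, b] h.
Proof.
move=> /ucont_continuous; exact: subspace_continuous_measurable_fun.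
Qed.

(** Dominated convergence to 0, with the limits written as inequalities. *)
Lemma integral_cvg0 a b (H : nat -> R -> R) (k : R -> R) :
  leb.-integrable `[a, b] (EFin \o k) ->
  (forall j, measurable_fun `[a, b] (H j)) ->
  (forall j t, a <= t <= b -> 0 <= H j t <= k t) ->
  (forall t, a <= t <= b -> forall e : R, 0 < e -> \forall j \near \oo, H j t <= e) ->
  forall e : R, 0 < e -> \forall j \near \oo, \int[leb]_(t in `[a, b]) H j t <= e.
Proof.
move=> ki Hm Hk H0 e e0.
have [||||||_ _] := @dominated_convergence _ _ _ leb `[a, b]%classic _
  (fun j => EFin \o H j) (cst 0%E) (EFin \o k).
- by [].
- by move=> j; apply/measurable_EFinP; exact: Hm.
- exact: measurable_cst.
- apply: aeW => t tab; apply: cvg_EFin; first exact: nearW.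
  apply/cvgr0Pnorm_le => e' e'0; have := H0 t tab e' e'0.
  apply: filterS => j; rewrite ger0_norm//.
  by have /andP[] := Hk j t tab.
- by [].
- apply: aeW => t j tab /=; have /andP[h1 h2] := Hk j t tab.
  by rewrite lee_fin ger0_norm.
rewrite integral0 => /fine_cvg /= /cvgr0Pnorm_le /(_ e e0).
apply: filterS => j; apply: le_trans; exact: ler_norm.
Qed.

End primitive.

(** * First-order expansions and the mean value inequality *)

Section calculus.
Context {R : realType}.

Lemma diff_approx (V W : normedModType R) (F : V -> W) p : differentiable F p ->
  forall eta : R, 0 < eta -> exists2 rho : R, 0 < rho & forall h, `|h| <= rho ->
    `|F (p + h) - F p - 'd F p h| <= eta * `|h|.
Proof.
move=> dF eta eta0.
have Fo := diff_locallyxC dF.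
have : \forall h \near (0 : V), `|F (p + h) - F p - 'd F p h| <= eta * `|h|.
  near=> h; rewrite Fo -addrA -opprD addrAC subrr add0r.
  by near: h; apply: littleoP.
move=> /nbhs_ballP[d /= d0 hd]; exists (d / 2); first by rewrite divr_gt0.
move=> h hd2; apply: hd; rewrite -ball_normE/= sub0r normrN.
by rewrite (le_lt_trans hd2)// ltr_pdivrMr// ltr_pMr// ltr1n.
Unshelve. all: by end_near. Qed.

Lemma is_derive_line (V W : normedModType R) (F : V -> W) (p q : V) (s : R) :
  differentiable F (p + s *: q) ->
  is_derive s 1 (fun r : R => F (p + r *: q)) ('d F (p + s *: q) q).
Proof.
move=> dF.
have dL : is_diff s (fun r : R => p + r *: q) (fun r : R => r *: q).
  have -> : (fun r : R => p + r *: q) = cst p + (fun r : R => r *: q) by [].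
  by apply: is_diff_eq; rewrite add0r.
have dFL : differentiable (F \o (fun r : R => p + r *: q)) s.
  by apply: differentiable_comp => //; exact: ex_diff.
apply: DeriveDef; first exact: diff_derivable.
by rewrite deriveE// diff_comp//= diff_val scale1r.
Qed.

Lemma mvt_cV n (F dF : R -> 'cV[R]_n) C : 0 <= C ->
  (forall s : R, is_derive s 1 F (dF s)) ->
  (forall s, 0 <= s <= 1 -> `|dF s| <= C) -> `|F 1 - F 0| <= C.
Proof.
move=> C0 FdF dFC; apply: mxnorm_le => // i j.
have dFi (s : R) : is_derive s 1 (fun r => F r i j) (dF s i j).
  have dFs : derivable F s 1 by exact: ex_derive.
  apply: DeriveDef; first exact: (derivable_mxP _ _ _).1.
  by have /matrixP/(_ i j) := derive_mx dFs; rewrite derive_val mxE => ->.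
have [|c c01 /= E] := @MVT_segment R (fun r => F r i j) (fun s => dF s i j) 0 1
  ler01 (fun s _ => dFi s).
  by apply: derivable_within_continuous => s _; exact: ex_derive.
rewrite !mxE E subr0 mulr1 (le_trans (entry_le_norm _ _ _))//.
by apply: dFC; rewrite in_itv/= in c01.
Qed.

Lemma cV_sum_delta p (w : 'cV[R]_p) : w = \sum_j w j 0 *: delta_mx j 0.
Proof.
apply/colP => i; rewrite summxE (bigD1 i)//= big1 ?addr0 => [|j ji].
  by rewrite !mxE !eqxx mulr1.
by rewrite !mxE eq_sym (negbTE ji) mulr0.
Qed.

Lemma jac_mul p q (F : 'cV[R]_p -> 'cV[R]_q) x w :
  jac F x *m w = 'd F x w.
Proof.
rewrite [in RHS](cV_sum_delta w) linear_sum; apply/colP => i; rewrite summxE mxE.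
by apply: eq_bigr => j _; rewrite linearZ !mxE mulrC.
Qed.

Lemma grad_mul p (G : 'cV[R]_p -> R) x w : (grad G x *m w) 0 0 = 'd G x w.
Proof.
rewrite [in RHS](cV_sum_delta w) linear_sum mxE.
by apply: eq_bigr => j _; rewrite linearZ !mxE mulrC.
Qed.

Lemma diff_partial1 (U V W : normedModType R) (F : U * V -> W) u v h :
  differentiable F (u, v) ->
  differentiable (fun x => F (x, v)) u /\
  'd (fun x => F (x, v)) u h = 'd F (u, v) (h, 0).
Proof.
move=> dF; have dL : is_diff u (fun x => (x, v)) (fun x => (x, 0)).
  by have := is_diff_pair (is_diff_id u) (is_diff_cst v u).
split; first by apply: (@differentiable_comp _ _ _ _ (fun x => (x, v)) F).
by rewrite (@diff_comp _ _ _ _ (fun x => (x, v)) F)//= diff_val.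
Qed.

Lemma diff_partial2 (U V W : normedModType R) (F : U * V -> W) u v h :
  differentiable F (u, v) ->
  differentiable (fun y => F (u, y)) v /\
  'd (fun y => F (u, y)) v h = 'd F (u, v) (0, h).
Proof.
move=> dF; have dL : is_diff v (fun y => (u, y)) (fun y => (0, y)).
  by have := is_diff_pair (is_diff_cst u v) (is_diff_id v).
split; first by apply: (@differentiable_comp _ _ _ _ (fun y => (u, y)) F).
by rewrite (@diff_comp _ _ _ _ (fun y => (u, y)) F)//= diff_val.
Qed.

End calculus.

(** * Gronwall estimate with an integrable coefficient *)

Section gronwall_primitive.
Context {R : realType}.
Notation leb := (@lebesgue_measure R).

(** The constant depends only on [k]: it is [2 ^+ N], where N intervals of equal
    length on which [k] has mass at most 1/2 cover [a, b].  It serves both for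
    the deviation of two solutions and for the error of the linearization. *)
Lemma gronwall_primitive n (a b : R) (k : R -> R) :
  leb.-integrable `[a, b] (EFin \o k) -> (forall t, a <= t <= b -> 0 <= k t) ->
  exists2 C : R, 1 <= C & forall c d r gamma (G X : R -> 'cV[R]_n) (h : R -> R),
    a <= c -> d <= b -> primitive c d G X ->
    leb.-integrable `[c, d] (EFin \o h) ->
    (forall t, c <= t <= d -> 0 <= h t) ->
    \int[leb]_(t in `[c, d]) h t <= gamma ->
    (forall t, c <= t <= d -> `|X t| <= r -> `|G t| <= k t * `|X t| + h t) ->
    C * (`|X c| + 2 * gamma) < r ->
    forall t, c <= t <= d -> `|X t| <= C * (`|X c| + 2 * gamma).
Proof.
move=> ki k0.
have [del del0 hdel] := integral_modulus ki (e := 1 / 2) ltac:(lra).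
pose N := (Num.truncn ((b - a) / del)).+1.
exists (2 ^+ N); first by rewrite exprn_ege1//; lra.
move=> c d r gamma G X h ac db GX hi h0 hg GXh Cr.
have g0 : 0 <= gamma.
  by apply: le_trans hg; apply: Rintegral_ge0 => x; rewrite /= in_itv/=; exact: h0.
apply: (@gronwall _ (fun t => `|X t|) c d r `|X c| gamma N del) => //.
- exact: ltW.
- have : b - a < N%:R * del by rewrite -ltr_pdivrMr// truncnS_gt.
  lra.
- exact/ucont_norm/(primitive_ucont GX).
move=> s t M cs st td tsd /andP[M0 Mr] XM.
have ki' : leb.-integrable `[s, t] (EFin \o k) by apply: integrable_itvS ki; lra.
have hi' : leb.-integrable `[s, t] (EFin \o h) by apply: integrable_itvS hi; lra.
have Mki : leb.-integrable `[s, t] (EFin \o (fun x => M * k x)).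
  by apply: eq_integrable (integrableZl _ M ki').
have Mkhi : leb.-integrable `[s, t] (EFin \o (fun x => M * k x + h x)).
  by apply: eq_integrable (integrableD _ Mki hi').
have : `|X t - X s| <= \int[leb]_(x in `[s, t]) (M * k x + h x).
  apply: (primitive_norm_le GX) => // x /andP[sx xt].
  have xM : `|X x| <= M by apply: XM; rewrite sx.
  apply: le_trans (GXh x _ _) _; [lra|lra|].
  by rewrite lerD2r mulrC ler_wpM2r// k0//; lra.
rewrite RintegralD// RintegralZl// => Xts.
have k12 : \int[leb]_(x in `[s, t]) k x <= 1 / 2.
  apply: le_trans (hdel s t _ st _ tsd); [|lra|lra].
  apply: le_Rintegral => //; first exact: integrable_normr.
  by move=> x _; exact: ler_norm.
have hg' : \int[leb]_(x in `[s, t]) h x <= gamma.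
  by apply: le_trans hg; apply: Rintegral_itvS => //; lra.
have := ler_wpM2l M0 k12.
have : `|X t| <= `|X s| + `|X t - X s|.
  by have := ler_normD (X s) (X t - X s); rewrite addrC subrK.
lra.
Qed.

End gronwall_primitive.

(** * Increments of a differentiable control field *)

Section field.
Context {R : realType} {n m : nat}.
Variable f : 'cV[R]_n -> 'cV[R]_m -> R -> 'cV[R]_n.
Let F (p : 'cV[R]_n * 'cV[R]_m * R) := f p.1.1 p.1.2 p.2.
Hypothesis dF : forall p, differentiable F p.

Lemma jac_state x u t w :
  jac (fun y => f y u t) x *m w = 'd F ((x, u), t) ((w, 0), 0).
Proof.
have [d1 <-] := diff_partial1 (w, 0) (dF ((x, u), t)).
by have [_ <-] := diff_partial1 w d1; rewrite jac_mul.
Qed.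

Lemma jac_input x u t w :
  jac (fun y => f x y t) u *m w = 'd F ((x, u), t) ((0, w), 0).
Proof.
have [d1 <-] := diff_partial1 (0, w) (dF ((x, u), t)).
by have [_ <-] := diff_partial2 w d1; rewrite jac_mul.
Qed.

Lemma field_lip_state x u t w K :
  (forall s, 0 <= s <= 1 -> `|jac (fun y => f y u t) (x + s *: w)| <= K) ->
  `|f (x + w) u t - f x u t| <= n%:R * K * `|w|.
Proof.
move=> hK.
have K0 : 0 <= K by apply: le_trans (hK 0 _); rewrite ?normr_ge0// lexx ler01.
have lineE s : F (((x, u), t) + s *: ((w, 0), 0)) = f (x + s *: w) u t.
  by rewrite /F/= !scaler0 !addr0.
have := @mvt_cV _ _ (fun s => F (((x, u), t) + s *: ((w, 0), 0))) _
  (n%:R * K * `|w|) _ (fun s => is_derive_line (dF _)).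
rewrite !lineE scale1r scale0r addr0; apply; first by rewrite !mulr_ge0.
move=> s /hK sK.
have -> : ((x, u), t) + s *: ((w, 0), 0) = ((x + s *: w, u), t).
  by congr ((_, _), _); rewrite /= ?scaler0 addr0.
by rewrite -jac_state (le_trans (norm_mulmx _ _))// ler_wpM2r// ler_wpM2l.
Qed.

Lemma field_lip_input x u t v e K :
  (forall s, 0 <= s <= 1 ->
     `|jac (fun w => f x w t) (u + (s * e) *: v) *m v| <= K) ->
  `|f x (u + e *: v) t - f x u t| <= `|e| * K.
Proof.
move=> hK.
have K0 : 0 <= K by apply: le_trans (hK 0 _); rewrite ?normr_ge0// lexx ler01.
have lineE s : F (((x, u), t) + s *: ((0, e *: v), 0)) = f x (u + (s * e) *: v) t.
  by rewrite /F/= !scaler0 !addr0 scalerA.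
have := @mvt_cV _ _ (fun s => F (((x, u), t) + s *: ((0, e *: v), 0))) _
  (`|e| * K) _ (fun s => is_derive_line (dF _)).
rewrite !lineE mul1r mul0r scale0r addr0; apply; first by rewrite !mulr_ge0.
move=> s /hK sK.
have -> : ((x, u), t) + s *: ((0, e *: v), 0) = ((x, u + (s * e) *: v), t).
  by congr ((_, _), _); rewrite /= ?scaler0 ?addr0 ?scalerA.
by rewrite -jac_input linearZ normrZ ler_wpM2l.
Qed.

Lemma field_approx x u v t eta : 0 < eta ->
  exists2 rho : R, 0 < rho & forall w e, `|w| + `|e| <= rho ->
    `|f (x + w) (u + e *: v) t - f x u t
      - (jac (fun y => f y u t) x *m w + e *: (jac (fun w => f x w t) u *m v))|
    <= eta * (`|w| + `|e|).
Proof.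
move=> eta0; have v1 : 0 < 1 + `|v| by rewrite ltr_pwDl.
have [rho rho0 hrho] := diff_approx (dF ((x, u), t)) (divr_gt0 eta0 v1).
exists (rho / (1 + `|v|)); first exact: divr_gt0.
move=> w e; rewrite ler_pdivlMr// => we.
pose h : 'cV[R]_n * 'cV[R]_m * R := ((w, e *: v), 0).
have hle : `|h| <= (`|w| + `|e|) * (1 + `|v|).
  rewrite !prod_normE/= normr0 normrZ !ge_max mulrDr mulr1.
  have p1 := normr_ge0 w; have p2 := normr_ge0 e; have p3 := normr_ge0 v.
  have p4 := mulr_ge0 p1 p3; have p5 := mulr_ge0 p2 p3.
  by rewrite -andbA; apply/and3P; split; nra.
have := hrho h (le_trans hle we).
have -> : 'd F ((x, u), t) h =
    jac (fun y => f y u t) x *m w + e *: (jac (fun w => f x w t) u *m v).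
  rewrite scalemxAr jac_state jac_input -linearD; congr ('d F _ _).
  by rewrite /h; congr ((_, _), _); rewrite /= ?addr0 ?add0r.
have -> : F ((x, u, t) + h) = f (x + w) (u + e *: v) t by rewrite /F/= addr0.
move=> /le_trans; apply; rewrite -mulrA ler_pM2l// ler_pdivrMl// mulrC.
exact: hle.
Qed.

End field.

(** * Differentiable dependence of Caratheodory solutions *)

Section linearization.
Context {R : realType} {n m : nat}.
Notation leb := (@lebesgue_measure R).
Variable f : 'cV[R]_n -> 'cV[R]_m -> R -> 'cV[R]_n.
Hypothesis dF : forall p : 'cV[R]_n * 'cV[R]_m * R,
  differentiable (fun p => f p.1.1 p.1.2 p.2) p.
Variables (a b : R) (xb : R -> 'cV[R]_n) (mu v : R -> 'cV[R]_m).
Hypothesis hxb : solution f mu a b xb.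
Variables (r : R) (k : R -> R).
Hypothesis r0 : 0 < r.
Hypothesis ki : leb.-integrable `[a, b] (EFin \o k).
Hypothesis hk : forall (t : R) (y : 'cV[R]_n) (e : R), a <= t -> t <= b ->
  `|y - xb t| <= r -> `|e| <= r ->
  `|jac (fun y' => f y' (mu t + e *: v t) t) y| <= k t /\
  `|jac (fun w => f y w t) (mu t + e *: v t) *m v t| <= k t.

Lemma jac_nominal t : a <= t <= b ->
  `|linA f xb mu t| <= k t /\ `|linB f xb mu t *m v t| <= k t.
Proof.
move=> /andP[at_ tb]; have := @hk t (xb t) 0 at_ tb.
rewrite subrr !normr0 scale0r addr0; apply; exact: ltW.
Qed.

Lemma k_ge0 t : a <= t <= b -> 0 <= k t.
Proof. by move=> /jac_nominal[h _]; exact: le_trans h. Qed.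

Lemma field_growth t y e : a <= t <= b -> `|y - xb t| <= r -> `|e| <= r ->
  `|f y (mu t + e *: v t) t - f (xb t) (mu t) t|
  <= n%:R * k t * `|y - xb t| + `|e| * k t.
Proof.
move=> /andP[at_ tb] yr er.
have ler_scale (s M : R) (V : normedModType R) (w : V) :
    0 <= s <= 1 -> `|w| <= M -> `|s *: w| <= M.
  move=> /andP[s0 s1] wM; rewrite normrZ ger0_norm//.
  by apply: le_trans wM; rewrite ler_piMl.
have h1 : `|f y (mu t + e *: v t) t - f (xb t) (mu t + e *: v t) t|
    <= n%:R * k t * `|y - xb t|.
  have {1}-> : y = xb t + (y - xb t) by rewrite addrC subrK.
  apply: field_lip_state => // s s01.
  apply: (hk at_ tb _ er).1; rewrite addrAC subrr add0r.
  exact: ler_scale.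
have h2 : `|f (xb t) (mu t + e *: v t) t - f (xb t) (mu t) t| <= `|e| * k t.
  apply: field_lip_input => // s s01.
  apply: (hk at_ tb _ _).2; first by rewrite subrr normr0 ltW.
  by have := ler_scale s r _ (e : R^o) s01 er.
rewrite -(subrKA (f (xb t) (mu t + e *: v t) t)).
exact: le_trans (ler_normD _ _) (lerD h1 h2).
Qed.

(** Lipschitz dependence on the initial value and on [e], with constants uniform
    in the interval [c, d] on which the perturbed solution lives: this interval
    will depend on [e], since one endpoint is the perturbed event time. *)
Lemma perturbation_bound : exists C rho : R, [/\ 0 <= C, 0 < rho &
  forall e c d x, a <= c -> c <= d -> d <= b ->
    solution f (fun t => mu t + e *: v t) c d x ->
    `|x c - xb c| + `|e| <= rho ->
    `|e| <= r /\ forall t, c <= t <= d ->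
      `|x t - xb t| <= C * (`|x c - xb c| + `|e|) /\ `|x t - xb t| <= r].
Proof.
have nki : leb.-integrable `[a, b] (EFin \o (fun t => n%:R * k t)).
  by apply: eq_integrable (integrableZl _ n%:R ki).
have nk0 t : a <= t <= b -> 0 <= n%:R * k t.
  by move=> tab; rewrite mulr_ge0// k_ge0.
have [C0 C01 gr] := @gronwall_primitive R n a b _ nki nk0.
pose K := \int[leb]_(t in `[a, b]) k t.
have K0 : 0 <= K.
  by apply: Rintegral_ge0 => x; rewrite /= in_itv/=; exact: k_ge0.
have C00 : 0 <= C0 by lra.
have CK := mulr_ge0 C00 K0.
pose C : R := C0 * (1 + 2 * K).
have C1 : 1 <= C by rewrite /C; nra.
exists C, (r / (2 * C)); split; [lra|by rewrite divr_gt0//; lra|].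
move=> e c d x ac cd db hx; rewrite ler_pdivlMr; last lra.
move=> hr.
have p1 := normr_ge0 (x c - xb c); have p2 := normr_ge0 e.
have CX : C * (`|x c - xb c| + `|e|) <= r / 2 by lra.
have CX0 : `|e| <= C * (`|x c - xb c| + `|e|) by nra.
have er : `|e| <= r by lra.
have le1 : C0 * (`|x c - xb c| + 2 * (`|e| * K)) <= C * (`|x c - xb c| + `|e|).
  rewrite /C -mulrA ler_wpM2l//; have := mulr_ge0 p1 K0; nra.
have cdab s : c <= s <= d -> a <= s <= b.
  by move=> /andP[cs sd]; rewrite (le_trans ac cs) (le_trans sd db).
split => // t tcd.
suff h : `|x t - xb t| <= C0 * (`|x c - xb c| + 2 * (`|e| * K)).
  by split; [exact: le_trans le1|apply: le_trans (le_trans h (le_trans le1 CX)) _; lra].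
have ki' : leb.-integrable `[c, d] (EFin \o k) by exact: integrable_itvS ki.
apply: (gr c d r (`|e| * K) _ (fun t => x t - xb t) (fun t => `|e| * k t)) => //.
- exact: primitiveB hx (primitiveS ac db hxb).
- by apply: eq_integrable (integrableZl _ `|e| ki').
- by move=> s scd; rewrite mulr_ge0// k_ge0// cdab.
- rewrite RintegralZl// ler_wpM2l//; apply: Rintegral_itvS => // s.
  exact: k_ge0.
- by move=> s scd xr; apply: field_growth => //; exact: cdab.
- by apply: le_lt_trans (le_trans le1 CX) _; move: r0; lra.
Qed.

Variable z : R -> 'cV[R]_n.
Hypothesis hz : solution (fun z w t => linA f xb mu t *m z
                                     + linB f xb mu t *m w) v a b z.

(** Sequences of parameters give access to dominated convergence.  Let [Y j] be
    the rescaled error and [G j] its derivative; [G j] differs from [linA *m Y j]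
    by a vanishing remainder.  The measurability in time of the derivative [linA]
    is not given, so this remainder is replaced by the excess [S j] of the
    entries of [G j] over [n k |Y j|], which inherits measurability from [G j],
    [k] and [Y j]. *)
Lemma linearization_seq (e_ c_ d_ : nat -> R) (x_ : nat -> R -> 'cV[R]_n) :
  (forall j, e_ j != 0) ->
  (forall eta : R, 0 < eta -> \forall j \near \oo, `|e_ j| <= eta) ->
  (forall j, [/\ a <= c_ j, c_ j <= d_ j, d_ j <= b
     & solution f (fun t => mu t + e_ j *: v t) (c_ j) (d_ j) (x_ j)]) ->
  (forall eta : R, 0 < eta -> \forall j \near \oo,
     `|x_ j (c_ j) - xb (c_ j) - e_ j *: z (c_ j)| <= eta * `|e_ j|) ->
  forall eta : R, 0 < eta -> \forall j \near \oo, forall t, c_ j <= t <= d_ j ->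
     `|x_ j t - xb t - e_ j *: z t| <= eta * `|e_ j|.
Proof.
move=> e0 ecv hx hinit.
have cdab j s : c_ j <= s <= d_ j -> a <= s <= b.
  move=> /andP[cs sd]; have [ac _ db _] := hx j.
  by rewrite (le_trans ac cs) (le_trans sd db).
have [Z Z0 hZ] := ucont_bounded (primitive_ucont hz).
have [C [rho [C_0 rho0 hC]]] := perturbation_bound.
pose D : R := C * (Z + 2).
have D0 : 0 <= D by rewrite mulr_ge0//; lra.
pose Y (j : nat) (t : R) : 'cV[R]_n := (e_ j)^-1 *: (x_ j t - xb t) - z t.
pose G (j : nat) (t : R) : 'cV[R]_n := (e_ j)^-1 *: (f (x_ j t) (mu t + e_ j *: v t) t
                            - f (xb t) (mu t) t)
              - (linA f xb mu t *m z t + linB f xb mu t *m v t).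
have GY j : primitive (c_ j) (d_ j) (G j) (Y j).
  have [ac _ db hxj] := hx j.
  apply: primitiveB; last exact: primitiveS hz.
  by apply: primitiveZ; apply: primitiveB; [exact: hxj|exact: primitiveS hxb].
have e_gt0 j : 0 < `|e_ j| by rewrite normr_gt0.
have eY j t : x_ j t - xb t - e_ j *: z t = e_ j *: Y j t.
  by rewrite /Y scalerBr scalerA divff// scale1r.
(* A priori x_ j deviates from xb by O(e_ j) only, which keeps the rescaled
   deviation in the ball of radius D. *)
have good : \forall j \near \oo, `|e_ j| <= r /\ forall t, c_ j <= t <= d_ j ->
    `|x_ j t - xb t| <= D * `|e_ j| /\ `|x_ j t - xb t| <= r.
  near=> j; have [ac cd db hxj] := hx j.
  have cj : c_ j <= c_ j <= d_ j by rewrite lexx.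
  have h1 : `|x_ j (c_ j) - xb (c_ j)| <= (Z + 1) * `|e_ j|.
    rewrite -[X in `|X|](subrK (e_ j *: z (c_ j))) (le_trans (ler_normD _ _))//.
    rewrite mulrDl mul1r addrC lerD//.
      by rewrite normrZ mulrC ler_wpM2r// hZ//; exact: cdab cj.
    by rewrite -[leRHS]mul1r; near: j; exact: hinit.
  have h2 : `|e_ j| <= rho / (Z + 2).
    by near: j; apply: ecv; rewrite divr_gt0//; lra.
  rewrite ler_pdivlMr in h2; last lra.
  have [er hr] := hC (e_ j) _ _ _ ac cd db hxj ltac:(lra).
  split => // t /hr[h3 h4]; split => //; apply: le_trans h3 _.
  by rewrite /D -mulrA ler_wpM2l//; lra.
pose S (j : nat) (t : R) : R := \sum_i Num.max 0 (`|G j t i 0| - n%:R * k t * `|Y j t|).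
have S0 j t : 0 <= S j t.
  by apply: sumr_ge0 => i _; rewrite le_max lexx.
pose Km : R := n%:R * (n%:R * D + 1 + n%:R * Z + 1).
(* Truncation by Km * k makes H j dominated for every j; the truncation is
   eventually inactive. *)
pose H (j : nat) : R -> R := (fun t => Num.min (Km * k t) (S j t)) \_ `[c_ j, d_ j].
have Km0 : 0 <= Km by rewrite !(mulr_ge0, addr_ge0).
have n0 : (0 : R) <= n%:R by [].
have inH j t : c_ j <= t <= d_ j -> H j t = Num.min (Km * k t) (S j t).
  by move=> tcd; rewrite /H patchE mem_set//= in_itv.
have outH j t : ~~ (c_ j <= t <= d_ j) -> H j t = 0.
  by move=> tcd; rewrite /H patchE memNset//= in_itv; exact/negP.
have H_ge0 j t : a <= t <= b -> 0 <= H j t <= Km * k t.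
  move=> tab; have k0 := k_ge0 tab.
  have [tcd|tcd] := boolP (c_ j <= t <= d_ j).
    by rewrite inH// le_min S0 ge_min lexx mulr_ge0.
  by rewrite outH// lexx mulr_ge0.
have mH j : measurable_fun `[a, b] (H j).
  have [ac _ db _] := hx j.
  apply/measurable_restrict => //.
  have -> : `[a, b]%classic `&` `[c_ j, d_ j]%classic = `[c_ j, d_ j]%classic.
    by apply: setIidr; apply: subset_itv; rewrite bnd_simp.
  have mk : measurable_fun `[c_ j, d_ j] k.
    have := measurable_int _ (integrable_itvS ac db ki).
    by move/measurable_EFinP.
  apply: measurable_minr; first exact: measurable_funM.
  apply: measurable_sum => i; apply: measurable_maxr => //.
  apply: measurable_funB.
    apply: measurableT_comp => //.
    by have := measurable_int _ ((GY j).1 i); move/measurable_EFinP.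
  apply: measurable_funM; first exact: measurable_funM.
  exact: (ucont_measurable (ucont_norm (primitive_ucont (GY j)))).
have GYdom : \forall j \near \oo, forall t, c_ j <= t <= d_ j ->
    S j t <= Km * k t.
  apply: filterS good => j [er hD] t tcd; have tab := cdab _ _ tcd.
  have [xD xr] := hD t tcd.
  have [hA hB] := jac_nominal tab; have k0 := k_ge0 tab.
  have hG : `|G j t| <= (n%:R * D + 1 + n%:R * Z + 1) * k t.
    have g1 := field_growth tab xr er.
    have g2 : `|linA f xb mu t *m z t| <= n%:R * k t * Z.
      rewrite (le_trans (norm_mulmx _ _))// ler_pM ?mulr_ge0//.
        by rewrite ler_wpM2l.
      exact: hZ.
    have g3 : `|(e_ j)^-1 *: (f (x_ j t) (mu t + e_ j *: v t) t
                            - f (xb t) (mu t) t)| <= (n%:R * D + 1) * k t.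
      rewrite normrZ normfV ler_pdivrMl// (le_trans g1)//.
      have := ler_wpM2l (mulr_ge0 n0 k0) xD; lra.
    have := ler_normB ((e_ j)^-1 *: (f (x_ j t) (mu t + e_ j *: v t) t
                            - f (xb t) (mu t) t))
              (linA f xb mu t *m z t + linB f xb mu t *m v t).
    have := ler_normD (linA f xb mu t *m z t) (linB f xb mu t *m v t).
    rewrite -/(G j t); lra.
  rewrite /Km -mulrA mulr_natl -[X in _ *+ X]card_ord -sumr_const ler_sum// => i _.
  rewrite ge_max (le_trans (normr_ge0 _) hG)/=.
  have := entry_le_norm (G j t) i 0.
  have := mulr_ge0 (mulr_ge0 n0 k0) (normr_ge0 (Y j t)); lra.
have Hpt t : a <= t <= b -> forall eps : R, 0 < eps ->
    \forall j \near \oo, H j t <= eps.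
  move=> tab eps eps0.
  have k0 := k_ge0 tab; have [hA hB] := jac_nominal tab.
  have nD : 0 < (n%:R + 1) * (D + 1) by rewrite mulr_gt0//; lra.
  have [rh rh0 happ] := field_approx dF (xb t) (mu t) (v t) t
    (divr_gt0 eps0 nD).
  have D1 : 0 < D + 1 by lra.
  near=> j.
  have [tcd|tcd] := boolP (c_ j <= t <= d_ j); last by rewrite outH// ltW.
  rewrite inH// ge_min; apply/orP; right.
  have [er hD] : `|e_ j| <= r /\ forall t, c_ j <= t <= d_ j ->
    `|x_ j t - xb t| <= D * `|e_ j| /\ `|x_ j t - xb t| <= r.
    by near: j; exact: good.
  have [xD xr] := hD t tcd.
  have h2 : `|e_ j| <= rh / (D + 1) by near: j; apply: ecv; exact: divr_gt0.
  rewrite ler_pdivlMr// in h2.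
  have := happ (x_ j t - xb t) (e_ j) ltac:(lra).
  rewrite [xb t + _]addrC subrK.
  set rem := (X in `|X| <= _) => hrem.
  (* the budget eps is shared among the n entries; n + 1 avoids division by 0 *)
  have hrem' : `|(e_ j)^-1 *: rem| <= eps / (n%:R + 1).
    rewrite normrZ normfV ler_pdivrMl// (le_trans hrem)//.
    rewrite invfM mulrA -[leLHS]mulrA [leRHS]mulrC.
    rewrite ler_wpM2l//; first by rewrite ltW// divr_gt0//; lra.
    by rewrite ler_pdivrMl//; lra.
  have GE : G j t = (e_ j)^-1 *: rem + linA f xb mu t *m Y j t.
    have alg (V : zmodType) (p q u w : V) : p - (u + w) = p - (q + w) + (q - u).
      by rewrite (opprD q) (addrC (- q)) !addrA subrK opprD addrA addrAC.
    rewrite /G /rem /Y [_ *m (_ - z t)]mulmxBr -scalemxAr [in RHS]scalerBr.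
    rewrite [_ *: (_ *m _ + _)]scalerDr scalerA.
    by rewrite mulVf// scale1r; exact: alg.
  have hAY : `|linA f xb mu t *m Y j t| <= n%:R * k t * `|Y j t|.
    by rewrite (le_trans (norm_mulmx _ _))// ler_wpM2r// ler_wpM2l.
  apply: (@le_trans _ _ (n%:R * (eps / (n%:R + 1)))).
    rewrite mulr_natl -[X in _ *+ X]card_ord -sumr_const ler_sum// => i _.
    rewrite ge_max; apply/andP; split.
      by rewrite ltW// divr_gt0//; lra.
    have := entry_le_norm (G j t) i 0.
    have : `|G j t| <= `|(e_ j)^-1 *: rem| + `|linA f xb mu t *m Y j t|.
      by rewrite GE ler_normD.
    lra.
  rewrite mulrCA ler_piMr//; first exact: ltW.
  by rewrite ler_pdivrMr ?mul1r; lra.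
move=> eta eta0.
have nki : leb.-integrable `[a, b] (EFin \o (fun t => n%:R * k t)).
  by apply: eq_integrable (integrableZl _ n%:R ki).
have nk0 t : a <= t <= b -> 0 <= n%:R * k t.
  by move=> tab; rewrite mulr_ge0// k_ge0.
have Kki : leb.-integrable `[a, b] (EFin \o (fun t => Km * k t)).
  by apply: eq_integrable (integrableZl _ Km ki).
have [C0 C01 gr] := @gronwall_primitive _ n _ _ _ nki nk0.
have g0 : 0 < eta / (3 * C0) by rewrite divr_gt0//; lra.
have gint := integral_cvg0 Kki mH H_ge0 Hpt g0.
near=> j; move=> t tcd.
have [ac cd db _] := hx j.
have hgam : \int[leb]_(t in `[a, b]) H j t <= eta / (3 * C0) by near: j.
have hj : forall t, c_ j <= t <= d_ j -> S j t <= Km * k t by near: j.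
have Hi : leb.-integrable `[a, b] (EFin \o H j).
  apply: le_integrable Kki => //; first by apply/measurable_EFinP; exact: mH.
  move=> x; rewrite /= in_itv/= => /(H_ge0 j)/andP[h1 h2].
  by rewrite lee_fin !ger0_norm// (le_trans h1).
have hY : `|Y j (c_ j)| <= eta / (3 * C0).
  rewrite -(ler_pM2l (e_gt0 j)) -normrZ -eY mulrC.
  by near: j; exact: hinit.
rewrite eY normrZ mulrC ler_wpM2r//.
have h3 : C0 * (`|Y j (c_ j)| + 2 * (eta / (3 * C0))) <= eta.
  apply: (@le_trans _ _ (C0 * (3 * (eta / (3 * C0))))).
    by rewrite ler_wpM2l//; lra.
  by rewrite le_eqVlt; apply/orP; left; apply/eqP; field; lra.
apply: le_trans h3.
apply: (gr (c_ j) (d_ j) (C0 * (`|Y j (c_ j)| + 2 * (eta / (3 * C0))) + 1) _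
  (G j) _ (H j)) => //.
- exact: integrable_itvS Hi.
- by move=> s scd; have /andP[] := H_ge0 j s (cdab _ _ scd).
- apply: le_trans hgam; apply: Rintegral_itvS => // s sab.
  by have /andP[] := H_ge0 j s sab.
- move=> s scd _; rewrite inH// min_r ?hj//.
  apply: mxnorm_le => [|i l].
    by rewrite addr_ge0// mulr_ge0// nk0//; exact: cdab scd.
  rewrite ord1 -lerBlDl;
  apply: le_trans (_ : _ <= Num.max 0 (`|G j s i 0| - n%:R * k s * `|Y j s|)) _.
    by rewrite le_max lexx orbT.
  by rewrite /S (bigD1 i)//= lerDl sumr_ge0// => l' _; rewrite le_max lexx.
- by rewrite ltrDl.
Unshelve. all: by end_near. Qed.

(** The interval may move with the parameter, as the perturbed event time does.
    A failure of the estimate would produce a sequence of parameters that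
    contradicts the previous lemma. *)
Lemma linearization_near (c_ d_ : R -> R) (x_ : R -> R -> 'cV[R]_n) :
  (\forall e \near (0 : R), [/\ a <= c_ e, c_ e <= d_ e, d_ e <= b
     & solution f (fun t => mu t + e *: v t) (c_ e) (d_ e) (x_ e)]) ->
  (forall eta : R, 0 < eta -> \forall e \near (0 : R),
     `|x_ e (c_ e) - xb (c_ e) - e *: z (c_ e)| <= eta * `|e|) ->
  forall eta : R, 0 < eta -> \forall e \near (0 : R),
    forall t, c_ e <= t <= d_ e -> `|x_ e t - xb t - e *: z t| <= eta * `|e|.
Proof.
move=> hx hinit eta eta0; apply: contrapT => nP.
pose P (e : R) := forall t, c_ e <= t <= d_ e ->
  `|x_ e t - xb t - e *: z t| <= eta * `|e|.
pose Q (e : R) := [/\ a <= c_ e, c_ e <= d_ e, d_ e <= b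
     & solution f (fun t => mu t + e *: v t) (c_ e) (d_ e) (x_ e)].
(* At e = 0 the error vanishes because solutions are unique; the other
   exceptional parameters can therefore be taken nonzero. *)
have P0 : Q 0 -> `|x_ 0 (c_ 0) - xb (c_ 0) - 0 *: z (c_ 0)| <= 1 * `|0 : R| -> P 0.
  move=> [ac cd db hx0]; rewrite scale0r subr0 normr0 mulr0 => x0 t tcd.
  have x00 : `|x_ 0 (c_ 0) - xb (c_ 0)| = 0.
    by apply/eqP; rewrite eq_le x0 normr_ge0.
  have [C [rho [C_0 rho0 hC]]] := perturbation_bound.
  have [|_ /(_ t tcd)[+ _]] := hC 0 _ _ _ ac cd db hx0.
    by rewrite x00 normr0 addr0 ltW.
  by rewrite x00 normr0 addr0 !mulr0 scale0r subr0.
have bad (j : nat) : exists e : R, [/\ `|e| <= j.+1%:R^-1, e != 0, Q e & ~ P e].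
  have j0 : 0 < j.+1%:R^-1 :> R by rewrite invr_gt0.
  apply: contrapT => none; apply: nP; near=> e; apply: contrapT => nPe.
  have Qe : Q e by near: e; exact: hx.
  have ej : `|e| <= j.+1%:R^-1 by near: e; have hj := @nbhs0_le R R^o _ j0; exact: hj.
  apply: none; exists e; split => //.
  apply/eqP => e0; apply: nPe; rewrite e0 in Qe *; apply: P0 => //.
  by rewrite -e0; near: e; exact: hinit.
have [e_ he] := choice bad.
have ecv (del : R) : 0 < del -> \forall j \near \oo, `|e_ j| <= del.
  move=> del0; near=> j; have [h _ _ _] := he j; apply: le_trans h _.
  apply: ltW; near: j.
  by have hj := near_infty_natSinv_lt (PosNum del0); exact: hj.
have ecv0 : e_ j @[j --> \oo] --> (0 : R) by apply/cvgr0Pnorm_le => del /ecv.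
have [||||j _ Pj] := @linearization_seq e_ (c_ \o e_) (d_ \o e_) (x_ \o e_)
  _ _ _ _ eta eta0.
- by move=> j; have [] := he j.
- exact: ecv.
- by move=> j; have [] := he j.
- by move=> del del0; have := ecv0 _ (hinit del del0).
have [_ _ _] := he j; apply; exact: Pj (leqnn j).
Unshelve. all: by end_near. Qed.

End linearization.

(** * Negligible remainders *)

Section negligible.
Context {R : realType}.

(** F = o(G) as the parameter tends to 0; the parameter 0 itself is included, so
    that F vanishes at 0 whenever G does. *)
Definition negl (V : normedModType R) (F : R -> V) (G : R -> R) :=
  forall eta : R, 0 < eta -> \forall e \near (0 : R), `|F e| <= eta * G e.

Lemma neglD (V : normedModType R) (F1 F2 : R -> V) G :
  negl F1 G -> negl F2 G -> negl (fun e => F1 e + F2 e) G.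
Proof.
move=> h1 h2 eta eta0; have eta20 : 0 < eta / 2 by lra.
apply: filterS2 (h1 _ eta20) (h2 _ eta20) => e e1 e2.
by apply: le_trans (ler_normD _ _) _; lra.
Qed.

Lemma negl_le (V W : normedModType R) (F : R -> V) (F' : R -> W) G C :
  (forall e, `|F' e| <= C * `|F e|) -> negl F G -> negl F' G.
Proof.
move=> FF h eta eta0.
have C1 : 0 < `|C| + 1 by rewrite ltr_wpDl.
apply: filterS (h _ (divr_gt0 eta0 C1)) => e Fe.
apply: le_trans (FF e) _.
apply: (@le_trans _ _ ((`|C| + 1) * `|F e|)).
  by rewrite ler_wpM2r//; have := ler_norm C; lra.
by rewrite -ler_pdivlMl// mulrA [_^-1 * _]mulrC.
Qed.

Lemma neglN (V : normedModType R) (F : R -> V) G :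
  negl F G -> negl (fun e => - F e) G.
Proof. by apply: (@negl_le _ _ _ _ _ 1) => e; rewrite normrN mul1r. Qed.

Lemma neglZr (V : normedModType R) (F : R -> R) (w : V) G :
  negl F G -> negl (fun e => F e *: w) G.
Proof.
by apply: (@negl_le _ _ _ _ _ `|w|) => e; rewrite normrZ mulrC.
Qed.

Lemma negl_mulmx p q (M : 'M[R]_(p, q)) (F : R -> 'cV[R]_q) G :
  negl F G -> negl (fun e => M *m F e) G.
Proof. by apply: negl_le => e; exact: norm_mulmx. Qed.

Lemma negl_scale (V : normedModType R) (F : R -> V) (G G' : R -> R) C :
  (\forall e \near (0 : R), G e <= C * G' e) ->
  (forall e, 0 <= G' e) -> negl F G -> negl F G'.
Proof.
move=> GG' G'0 h eta eta0.
have C1 : 0 < `|C| + 1 by rewrite ltr_wpDl.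
have e0 := divr_gt0 eta0 C1.
apply: filterS2 (h _ e0) GG' => e Fe Ge.
apply: le_trans Fe _; rewrite -mulrA ler_pM2l// ler_pdivrMl//.
apply: le_trans Ge _; rewrite ler_wpM2r//.
by have := ler_norm C; lra.
Qed.

Lemma eq_negl (V : normedModType R) (F F' : R -> V) G :
  (\forall e \near (0 : R), F' e = F e) -> negl F G -> negl F' G.
Proof.
by move=> FF h eta eta0; apply: filterS2 FF (h _ eta0) => e ->.
Qed.

Lemma negl_diff (V W : normedModType R) (Phi : V -> W) p (h : R -> V) G C :
  differentiable Phi p -> (\forall e \near (0 : R), `|h e| <= C * G e) ->
  (forall e, 0 <= G e) ->
  (forall rho : R, 0 < rho -> \forall e \near (0 : R), G e <= rho) ->
  negl (fun e => Phi (p + h e) - Phi p - 'd Phi p (h e)) G.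
Proof.
move=> dPhi hC G0 Gcv; apply: (negl_scale hC) => // eta eta0.
have [rho rho0 hr] := diff_approx dPhi eta0.
have C1 : 0 < `|C| + 1 by rewrite ltr_wpDl.
apply: filterS2 hC (Gcv _ (divr_gt0 rho0 C1)) => e he Ge.
have hr' : `|h e| <= rho.
  apply: le_trans he _.
  apply: (@le_trans _ _ ((`|C| + 1) * G e)).
    by rewrite ler_wpM2r//; have := ler_norm C; lra.
  by rewrite -ler_pdivlMl// mulrC.
apply: le_trans (hr _ hr') _; rewrite ler_wpM2l//; exact: ltW.
Qed.

End negligible.

(** * First-order expansion at the event *)

Section event.
Context {R : realType}.

Lemma diff_state_time p (W : normedModType R) (Phi : 'cV[R]_p -> R -> W) a t w s :
  differentiable (fun q : 'cV[R]_p * R => Phi q.1 q.2) (a, t) ->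
  'd (fun q : 'cV[R]_p * R => Phi q.1 q.2) (a, t) (w, s) =
  'd (fun x => Phi x t) a w + s *: derive1 (fun r => Phi a r) t.
Proof.
move=> dPhi.
have [_ /= ->] := diff_partial1 w dPhi.
have [d2 /= E] := diff_partial2 s dPhi.
have -> : s *: derive1 (fun r => Phi a r) t = 'd (fun r => Phi a r) t s.
  by rewrite deriv1E//; apply/derivable1_diffP.
by rewrite E -linearD; congr ('d _ _ _); congr pair; rewrite /= ?addr0 ?add0r.
Qed.

Variables (tau : R) (tau_ : R -> R).
Hypothesis tau_cvg : tau_ e @[e --> (0 : R)] --> tau.
Let del e := tau_ e - tau.

Lemma negl_ode n (t0 t1 : R) (x : R -> 'cV[R]_n) (F : 'cV[R]_n) :
  (\forall e \near (0 : R), t0 <= tau_ e <= t1) ->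
  ((fun t => (t - tau)^-1 *: (x t - x tau)) @ within `[t0, t1] (tau^') --> F) ->
  negl (fun e => x (tau_ e) - x tau - del e *: F) (fun e => `|del e|).
Proof.
move=> tin xF eta eta0.
have {}xF := (cvgrPdist_le _ _).1 xF eta eta0.
have {}xF : nbhs tau (fun t : R => t != tau -> `[t0, t1]%classic t ->
    `|F - (t - tau)^-1 *: (x t - x tau)| <= eta) by exact: xF.
have {}xF := tau_cvg xF; rewrite /= in xF.
apply: filterS2 tin xF => e {}tin {}xF; have [te|te] := eqVneq (tau_ e) tau.
  by rewrite /del te !subrr scale0r subr0 !normr0 mulr0.
have d0 : del e != 0 by rewrite subr_eq0.
have := xF te; rewrite /= in_itv/= => /(_ tin); rewrite -/(del e) => h.
have -> : x (tau_ e) - x tau - del e *: F =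
    - (del e *: (F - (del e)^-1 *: (x (tau_ e) - x tau))).
  by rewrite scalerBr scalerA divff// scale1r opprB.
by rewrite normrN normrZ mulrC ler_wpM2r.
Qed.

Lemma negl_ucont n (t0 t1 : R) (z : R -> 'cV[R]_n) : t0 <= tau <= t1 ->
  (\forall e \near (0 : R), t0 <= tau_ e <= t1) -> ucont t0 t1 z ->
  negl (fun e => e *: (z (tau_ e) - z tau)) (fun e => `|e|).
Proof.
move=> /andP[t0tau taut1] tin uz eta eta0; have [d d0 hd] := uz eta eta0.
have tcv : \forall e \near (0 : R), `|tau - tau_ e| <= d.
  exact: (cvgrPdist_le _ _).1 tau_cvg d d0.
apply: filterS2 tin tcv => e /andP[h1 h2]; rewrite ler_norml => /andP[h3 h4].
rewrite normrZ mulrC ler_wpM2r//.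
case: (leP tau (tau_ e)) => [h|/ltW h].
  by apply: hd => //; lra.
by rewrite distrC; apply: hd => //; lra.
Qed.

(** [X] is the increment of the ante-event state at the perturbed event time,
    [fm] its velocity and [zt] its variation in the parameter. *)
Variables (n : nat) (g : 'cV[R]_n -> R -> R) (al fm zt : 'cV[R]_n) (X : R -> 'cV[R]_n).
(** The shift [del] of the event time is not yet known to be O(e), so remainders
    are first measured against both small quantities. *)
Let gauge e := `|del e| + `|e|.
Hypothesis Xexp : negl (fun e => X e - del e *: fm - e *: zt) gauge.

Lemma gauge_ge0 e : 0 <= gauge e. Proof. exact: addr_ge0. Qed.

Lemma gauge_small (rho : R) : 0 < rho -> \forall e \near (0 : R), gauge e <= rho.
Proof.
move=> rho0; have r2 : 0 < rho / 2 by lra.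
have h1 : \forall e \near (0 : R), `|tau - tau_ e| <= rho / 2.
  exact: (cvgrPdist_le _ _).1 tau_cvg _ r2.
have h2 := @nbhs0_le R R^o _ r2.
apply: filterS2 h1 h2 => e e1 e2; rewrite /gauge /del distrC; lra.
Qed.

Lemma increment_le : exists C : R,
  \forall e \near (0 : R), `|(X e, del e)| <= C * gauge e.
Proof.
exists (1 + `|fm| + `|zt|).
apply: filterS (Xexp ltr01) => e; rewrite mul1r => h.
have p1 := normr_ge0 (del e); have p2 := normr_ge0 e.
have p3 := mulr_ge0 (normr_ge0 fm) p1; have p4 := mulr_ge0 (normr_ge0 zt) p2.
have p5 := mulr_ge0 (normr_ge0 fm) p2; have p6 := mulr_ge0 (normr_ge0 zt) p1.
have hX : `|X e| <= gauge e + `|e| * `|zt| + `|del e| * `|fm|.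
  have -> : X e = (X e - del e *: fm - e *: zt) + e *: zt + del e *: fm.
    by rewrite !subrK.
  rewrite -!normrZ (le_trans (ler_normD _ _))// lerD2r.
  by rewrite (le_trans (ler_normD _ _))// lerD2r.
rewrite prod_normE/= ge_max; apply/andP; split; first apply: le_trans hX _;
  rewrite /gauge; lra.
Qed.

(** This serves both for the event function and for the jump map. *)
Lemma negl_event (W : normedModType R) (Phi : 'cV[R]_n -> R -> W) :
  differentiable (fun q : 'cV[R]_n * R => Phi q.1 q.2) (al, tau) ->
  negl (fun e => Phi (al + X e) (tau_ e) - Phi al tau
    - ('d (fun x => Phi x tau) al (X e)
       + del e *: derive1 (fun r => Phi al r) tau)) gauge.
Proof.
move=> dPhi; have [C hC] := increment_le.
have h := negl_diff dPhi hC gauge_ge0 gauge_small.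
refine (eq_negl _ h); near=> e => /=.
by rewrite diff_state_time// /del [tau + _]addrC subrK.
Unshelve. all: by end_near. Qed.

Hypothesis dg : differentiable (fun q : 'cV[R]_n * R => g q.1 q.2) (al, tau).
Hypothesis g0 : g al tau = 0.
Hypothesis gX : \forall e \near (0 : R), g (al + X e) (tau_ e) = 0.
Let D1g := grad (fun x => g x tau) al.
Let gd := (D1g *m fm) 0 0 + derive1 (fun r => g al r) tau.
Hypothesis gd0 : gd != 0.

(** Expanding 0 = g at the perturbed event and inserting the expansion of [X];
    transversality allows division by [gd]. *)
Lemma negl_event_time_gauge : negl (fun e => del e + e * (gd^-1 * (D1g *m zt) 0 0)) gauge.
Proof.
have h1 := negl_event dg.
have h2 : negl (fun e => (D1g *m (X e - del e *: fm - e *: zt)) 0 0) gauge.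
  apply: (@negl_le _ _ _ _ _ _ 1 _ (negl_mulmx D1g Xexp)) => e.
  by rewrite mul1r entry_le_norm.
have h3 := neglN (neglD h1 h2).
have {h1 h2} h4 : negl (fun e => gd * del e + e * (D1g *m zt) 0 0) gauge.
  refine (eq_negl _ h3); apply: filterS gX => e ge.
  rewrite ge g0 -grad_mul -/D1g !mulmxBr -!scalemxAr !mxE /gd /GRing.scale/=.
  by rewrite mxE; ring.
apply: (@negl_le _ _ _ _ _ _ `|gd^-1| _ h4) => e.
by rewrite -normrM mulrDr mulKf// mulrCA lexx.
Qed.

(** The event time is Lipschitz in the parameter at 0: half of the gauge in the
    previous estimate is absorbed into the left-hand side. *)
Lemma gauge_le : exists C : R, \forall e \near (0 : R), gauge e <= C * `|e|.
Proof.
pose c := gd^-1 * (D1g *m zt) 0 0.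
exists (2 * (1 + `|c|)); have h12 : (0 : R) < 1 / 2 by lra.
apply: filterS (negl_event_time_gauge h12) => e; rewrite -/c => h.
have : `|del e| <= 1 / 2 * gauge e + `|e| * `|c|.
  have {1}-> : del e = (del e + e * c) - e * c by rewrite addrK.
  by rewrite -normrM (le_trans (ler_normB _ _))// lerD2r.
rewrite /gauge; lra.
Qed.

Lemma negl_event_time :
  negl (fun e => del e + e * (gd^-1 * (D1g *m zt) 0 0)) (fun e => `|e|).
Proof. by have [C hC] := gauge_le; exact: negl_scale hC _ negl_event_time_gauge. Qed.

End event.

Unset Implicit Arguments.
Set Strict Implicit.
Set Printing Implicit Defensive.

Theorem mainTheorem1 (R : realType) (n m : nat) (S : hybrid_system R n m)
  (hS : smooth_system S)
  (t0 t1 tau : R) (x0 : 'cV[R]_n) (mu : R -> 'cV[R]_m)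
  (alpha_a alpha_p : R -> 'cV[R]_n)
  (hmu : integrable_curve t0 t1 mu)
  (halpha : hybrid_trajectory S t0 t1 x0 mu tau alpha_a alpha_p)
  (* extended ante- and post-event trajectories *)
  (bar_a bar_p : R -> 'cV[R]_n)
  (hbar_a : solution (fa S) mu t0 t1 bar_a)
  (hbar_aE : forall t, t0 <= t <= tau -> bar_a t = alpha_a t)
  (hbar_p : solution (fp S) mu t0 t1 bar_p)
  (hbar_pE : forall t, tau <= t <= t1 -> bar_p t = alpha_p t)
  (* the differential equations hold at the event time *)
  (hode_a : ode_at (fa S) mu t0 t1 bar_a tau)
  (hode_p : ode_at (fp S) mu t0 t1 bar_p tau)
  (* transversality *)
  (htrans : (grad (fun x => ev S x tau) (alpha_a tau)
               *m fa S (alpha_a tau) (mu tau) tau) 0 0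
            + derive1 (fun s => ev S (alpha_a tau) s) tau * 1 != 0)
  (z0 : 'cV[R]_n) (v : R -> 'cV[R]_m)
  (hv : integrable_curve t0 t1 v)
  (hdom_a : dominated_along (fa S) t0 t1 bar_a mu v)
  (hdom_p : dominated_along (fp S) t0 t1 bar_p mu v)
  (* perturbed trajectories, for small epsilon *)
  (tau_ : R -> R) (xa_ xp_ : R -> R -> 'cV[R]_n)
  (htau0 : tau_ 0 = tau)
  (htau_cont : {for 0, continuous tau_})
  (hpert : \forall e \near (0 : R),
     hybrid_trajectory S t0 t1 (x0 + e *: z0) (fun t => mu t + e *: v t)
       (tau_ e) (xa_ e) (xp_ e))
  (* extended linearization trajectories *)
  (za zp : R -> 'cV[R]_n)
  (hza0 : za t0 = z0)
  (hza : solution (fun z w t => linA (fa S) bar_a mu t *m z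
                              + linB (fa S) bar_a mu t *m w) v t0 t1 za)
  (hzp0 : zp tau = za tau + Hmat S mu tau alpha_a alpha_p *m za tau)
  (hzp : solution (fun z w t => linA (fp S) bar_p mu t *m z
                              + linB (fp S) bar_p mu t *m w) v t0 t1 zp) :
  forall eta : R, 0 < eta ->
    \forall e \near (0 : R), forall t, t0 <= t <= t1 ->
      `| switched (tau_ e) (xa_ e) (xp_ e) t
         - switched (tau_ e) (fun s => bar_a s + e *: za s)
                             (fun s => bar_p s + e *: zp s) t |
      <= eta * `|e|.
Proof.
have [dfa' dfp' dev' djump' _] := hS.
have dfa p : differentiable (fun p : 'cV[R]_n * 'cV[R]_m * R => fa S p.1.1 p.1.2 p.2) p.
  by have [] := dfa' p I.
have dfp p : differentiable (fun p : 'cV[R]_n * 'cV[R]_m * R => fp S p.1.1 p.1.2 p.2) p.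
  by have [] := dfp' p I.
have dev q : differentiable (fun q : 'cV[R]_n * R => ev S q.1 q.2) q.
  by have [] := dev' q I.
have djump q : differentiable (fun q : 'cV[R]_n * R => jump S q.1 q.2) q.
  by have [] := djump' q I.
have [/andP[t0tau taut1] [alx0 _] al_ev al_jump _] := halpha.
have al_tau : bar_a tau = alpha_a tau by rewrite hbar_aE// t0tau lexx.
have ap_tau : bar_p tau = alpha_p tau by rewrite hbar_pE// taut1 lexx.
have bar_x0 : bar_a t0 = x0 by rewrite hbar_aE// lexx t0tau.
have tau_cvg : tau_ e @[e --> (0 : R)] --> tau by rewrite -htau0; exact: htau_cont.
have tin : \forall e \near (0 : R), t0 <= tau_ e <= t1.
  by apply: filterS hpert => e [].
have [ra [ka [ra0 kai hka]]] := hdom_a.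
have [rp [kp [rp0 kpi hkp]]] := hdom_p.
have lin_a : forall eta : R, 0 < eta -> \forall e \near (0 : R),
    forall t, t0 <= t <= tau_ e ->
      `|xa_ e t - bar_a t - e *: za t| <= eta * `|e|.
  apply: (linearization_near dfa hbar_a ra0 kai hka hza (c_ := fun=> t0)).
    by apply: filterS hpert => e [/andP[h1 h2] [_ h3] _ _ _]; split.
  move=> eta eta0; apply: filterS hpert => e [_ [h _] _ _ _].
  by rewrite h bar_x0 hza0 -addrA -opprD subrr normr0 mulr_ge0// ltW.
pose al := alpha_a tau.
pose fm := fminus S mu tau alpha_a.
pose fpl := fplus S mu tau alpha_p.
pose del e := tau_ e - tau.
pose X e := xa_ e (tau_ e) - al.
pose G e := `|del e| + `|e|.
have del_G (V : normedModType R) (F : R -> V) : negl F (fun e => `|del e|) -> negl F G.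
  move=> h; refine (negl_scale (C := 1) _ (fun e => addr_ge0 _ _) h) => //.
  by near=> e; rewrite mul1r lerDl.
have e_G (V : normedModType R) (F : R -> V) : negl F (fun e => `|e|) -> negl F G.
  move=> h; refine (negl_scale (C := 1) _ (fun e => addr_ge0 _ _) h) => //.
  by near=> e; rewrite mul1r lerDr.
have r_a : negl (fun e => xa_ e (tau_ e) - bar_a (tau_ e) - e *: za (tau_ e))
    (fun e => `|e|).
  move=> eta eta0; apply: filterS2 (lin_a eta eta0) tin => e h /andP[h1 _].
  by apply: h; rewrite h1 lexx.
have r_za := negl_ucont tau_cvg (introT andP (conj t0tau taut1)) tin
  (primitive_ucont hza).
have r_zp := negl_ucont tau_cvg (introT andP (conj t0tau taut1)) tin
  (primitive_ucont hzp).
have r_fa := negl_ode tau_cvg tin hode_a.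
have r_fp : negl (fun e => bar_p (tau_ e) - alpha_p tau - del e *: fpl)
    (fun e => `|del e|).
  have h := negl_ode tau_cvg tin hode_p.
  by rewrite /fpl /fplus -ap_tau; exact: h.
(* X splits into the deviation from the linearized ante-event solution, the
   variation of za over the vanishing interval between the two event times,
   and the displacement of bar_a over that interval. *)
have Xexp : negl (fun e => X e - del e *: fm - e *: za tau) G.
  have h := neglD (neglD (e_G _ _ r_a) (e_G _ _ r_za)) (del_G _ _ r_fa).
  refine (eq_negl _ h); near=> e; rewrite /X /al /del /fm /fminus al_tau.
  rewrite scalerBr; apply/colP => i; rewrite !mxE; ring.
have gX : \forall e \near (0 : R), ev S (al + X e) (tau_ e) = 0.
  by apply: filterS hpert => e [_ _ h _ _]; rewrite /X addrC subrK.
have gd0 : gdot S mu tau alpha_a != 0 by move: htrans; rewrite mulr1.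
pose s := (gdot S mu tau alpha_a)^-1 * (D1g S tau alpha_a *m za tau) 0 0.
have r_tau : negl (fun e => del e + e * s) (fun e => `|e|).
  by have h := negl_event_time tau_cvg Xexp (dev (al, tau)) al_ev gX gd0; exact: h.
have [C hC] := gauge_le tau_cvg Xexp (dev (al, tau)) al_ev gX gd0.
have G_e (V : normedModType R) (F : R -> V) : negl F G -> negl F (fun e => `|e|).
  by move=> h; exact: negl_scale hC _ h.
have r_j := negl_event tau_cvg Xexp (djump (al, tau)).
pose J := fpl - fm - jumpdot S mu tau alpha_a.
have zpE : zp tau = za tau + s *: J + D1jump S tau alpha_a *m za tau.
  rewrite hzp0 /Hmat mulmxDl addrA -mulmxA; congr (_ + _ + _).
  rewrite [D1g _ _ _ *m _]mx11_scalar mul_mx_scalar scalerA mulrC.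
  by [].
(* The terms of order e and del cancel by the definition of the jump matrix. *)
have init_p : negl (fun e => xp_ e (tau_ e) - bar_p (tau_ e) - e *: zp (tau_ e))
    (fun e => `|e|).
  have h1 := neglD (G_e _ _ Xexp) (G_e _ _ (negl_mulmx (D1jump S tau alpha_a) Xexp)).
  have h2 := neglD h1 (G_e _ _ r_j).
  have h3 := neglD h2 (neglN (neglD (G_e _ _ (del_G _ _ r_fp)) r_zp)).
  have h4 := neglD h3 (neglN (neglZr J r_tau)).
  refine (eq_negl _ h4); apply: filterS hpert => e [_ _ _ hxp _].
  have XE : xa_ e (tau_ e) = al + X e by rewrite /X [RHS]addrC subrK.
  rewrite hxp XE al_jump zpE -jac_mul -/(D1jump S tau alpha_a).
  rewrite -/(D2jump S tau alpha_a) /J /jumpdot -/al -/(del e) -/fm.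
  move: (X e) (D1jump S tau alpha_a) (D2jump S tau alpha_a) => x D1 D2.
  rewrite !mulmxBr -!scalemxAr.
  move: (D1 *m x) (D1 *m fm) (D1 *m za tau) => p q w.
  by apply/colP => i; rewrite !mxE; ring.
have lin_p : forall eta : R, 0 < eta -> \forall e \near (0 : R),
    forall t, tau_ e <= t <= t1 ->
      `|xp_ e t - bar_p t - e *: zp t| <= eta * `|e|.
  apply: (linearization_near dfp hbar_p rp0 kpi hkp hzp (d_ := fun=> t1)) => //.
  by apply: filterS hpert => e [/andP[h1 h2] _ _ _ h3]; split.
move=> eta eta0; near=> e => t /andP[t0t tt1].
rewrite /switched; case: ltP => [ttau|taut]; rewrite opprD addrA.
  have h : forall t, t0 <= t <= tau_ e ->
      `|xa_ e t - bar_a t - e *: za t| <= eta * `|e| by near: e; exact: lin_a.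
  by apply: h; rewrite t0t ltW.
have h : forall t, tau_ e <= t <= t1 ->
    `|xp_ e t - bar_p t - e *: zp t| <= eta * `|e| by near: e; exact: lin_p.
by apply: h; rewrite taut.
Unshelve. all: by end_near. Qed.
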